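(* Let $X,Y\subset\mathbb{R}^d$ be compact, let $c:X\times Y\to\mathbb{R}$ be a cost function as in the context, and let $R>0$ with $B_R\times B_R\subseteq X\times Y$. Let $\mu$ and $\nu$ be two measures such that $$\operatorname{Spt}\mu\subseteq B_R,\quad\operatorname{Spt}\nu\subseteq B_R,\quad\mu(B_R)\le2|B_R|.$$ Let $\pi\in\Pi(\mu,\nu)$ be a $c$-optimal coupling between $\mu$ and $\nu$. Then $\pi$ is almost-minimizing for the Euclidean cost, in the sense that for any $\widetilde\pi\in\Pi(\mu,\nu)$ $$\int\frac12|x-y|^2\,d\pi\le\int\frac12|x-y|^2\,d\widetilde\pi+R^{d+2}\Delta_R,\qquad\Delta_R:=C\,\|\nabla_{xy}c+\mathbb{I}\|_{\mathcal{C}^0(B_R\times B_R)}\,\mathcal{E}_R(\pi)^{\frac12},$$ for some constant $C$ depending only on $d$.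
   Context: Standing assumptions on the cost: (C1) $c\in\mathcal{C}^2(X\times Y)$; (C2) for any $x\in X$, $Y\ni y\mapsto-\nabla_xc(x,y)$ is one-to-one; (C3) for any $y\in Y$, $X\ni x\mapsto-\nabla_yc(x,y)$ is one-to-one; (C4) $\det\nabla_{xy}c\ne0$ on $X\times Y$, where $\nabla_{xy}c$ is the matrix of mixed second derivatives. $\mathbb{I}$ is the identity matrix. $B_R$ is the ball of radius $R$ centered at $0$ in $\mathbb{R}^d$, $|B_R|$ its Lebesgue measure. $\Pi(\mu,\nu)$ is the set of couplings of $\mu,\nu$; a coupling is $c$-optimal if it minimizes $\int c\,d\pi$ over $\Pi(\mu,\nu)$. $\mathcal{E}_R(\pi):=\frac1{R^{d+2}}\int_{\#_R}\frac12|x-y|^2\,d\pi$ with $\#_R:=(B_R\times\mathbb{R}^d)\cup(\mathbb{R}^d\times B_R)$. *)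

(* Defs.v *)
From HB Require Import structures.
From mathcomp Require Import all_boot all_order all_algebra.
From mathcomp Require Import all_classical all_reals all_analysis.
Set Implicit Arguments.
Unset Strict Implicit.
Unset Printing Implicit Defensive.
Import Order.TTheory GRing.Theory Num.Theory.
Import numFieldNormedType.Exports.
Local Open Scope classical_set_scope.
Local Open Scope ring_scope.

(* R^d is 'rV[R]_d. Its library norm `|x| is the sup norm, which only serves
   for the topology and differentiability here; see enorm below. *)

Definition borel_rV_display : measure_display. Proof. exact. Qed.

(* Borel sigma-algebra; 'rV[R]_d * 'rV[R]_d then carries the product
   sigma-algebra, which is the Borel one by second countability. *)
HB.instance Definition _ (R : realType) (d : nat) :=
  @isMeasurable.Build borel_rV_display 'rV[R]_d <<s @open 'rV[R]_d >>
    (@sigma_algebra0 _ setT _) (@sigma_algebraC _ _)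
    (@sigma_algebra_bigcup _ setT _).

Section euclidean.
Context {R : realType}.

(* Euclidean norm of a vector, Frobenius norm of a matrix. *)
Definition enorm m n (A : 'M[R]_(m, n)) : R :=
  Num.sqrt (\sum_i \sum_j A i j ^+ 2).

Definition eball d (r : R) : set 'rV[R]_d := [set x | enorm x < r].

Definition box d (a b : 'rV[R]_d) : set 'rV[R]_d :=
  [set x | forall i, a 0 i <= x 0 i <= b 0 i].

(* d-dimensional Lebesgue (outer) measure, by countable covers with boxes;
   meaningful for 0 < d only, since boxes have volume 1 when d = 0. *)
Definition lebesgue_rV d (A : set 'rV[R]_d) : \bar R :=
  ereal_inf
    [set (\sum_(0 <= k <oo) (\prod_i ((J k).2 0 i - (J k).1 0 i))%:E)%E |
      J in [set J : nat -> 'rV[R]_d * 'rV[R]_d |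
        (forall k i, (J k).1 0 i <= (J k).2 0 i) /\
        A `<=` \bigcup_k box (J k).1 (J k).2]].

End euclidean.
Arguments eball {R} d r.

Section cost.
Context {R : realType} {d : nat}.
Local Notation E := 'rV[R]_d.
Implicit Types (c : E * E -> R) (X Y : set E) (z : E * E).

(* In finite dimension, C^(k+1) on an open set means differentiable with all
   directional derivatives of class C^k. *)
Fixpoint Ck_on (k : nat) (U : set (E * E)) (f : E * E -> R) : Prop :=
  if k is k'.+1 then
    (forall z, U z -> differentiable f z) /\
    (forall v, Ck_on k' U (fun z => 'D_v f z))
  else forall z, U z -> {for z, continuous f}.

(* C^2 up to the boundary of the compact set X x Y, in the sense of
   restrictions of C^2 functions on an open neighbourhood. *)
Definition C2_cost X Y c : Prop :=
  exists U : set (E * E), [/\ open U, X `*` Y `<=` U & Ck_on 2 U c].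

Definition partialx (i : 'I_d) c z : R := 'D_(delta_mx 0 i, 0) c z.
Definition partialy (j : 'I_d) c z : R := 'D_(0, delta_mx 0 j) c z.

Definition gradx c z : E := \row_i partialx i c z.
Definition grady c z : E := \row_j partialy j c z.

Definition hessxy c z : 'M[R]_d := \matrix_(i, j) partialx i (partialy j c) z.

Definition cost_function X Y c : Prop :=
  [/\ C2_cost X Y c,
      forall x, X x -> set_inj Y (fun y => - gradx c (x, y)),
      forall y, Y y -> set_inj X (fun x => - grady c (x, y)) &
      forall x y, X x -> Y y -> \det (hessxy c (x, y)) != 0].

Definition C0_norm (A : set (E * E)) (F : E * E -> 'M[R]_d) : R :=
  sup [set enorm (F z) | z in A].

End cost.

Section transport.
Context {R : realType} {d : nat}.
Local Notation E := 'rV[R]_d.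
Local Open Scope ereal_scope.
Implicit Types (mu nu : {measure set E -> \bar R})
  (pi : {measure set (E * E)%type -> \bar R}) (r : R).

Definition Spt mu : set E := [set x | forall U, open U -> U x -> 0 < mu U].

Definition coupling mu nu pi : Prop := forall A : set E, measurable A ->
  pushforward pi fst A = mu A /\ pushforward pi snd A = nu A.

(* The cost only matters on X x Y: its values elsewhere are arbitrary. *)
Definition c_optimal (X Y : set E) (c : E * E -> R) mu nu pi : Prop :=
  coupling mu nu pi /\
  forall pi' : {measure set (E * E)%type -> \bar R}, coupling mu nu pi' ->
    \int[pi]_(z in X `*` Y) (c z)%:E <= \int[pi']_(z in X `*` Y) (c z)%:E.

Definition sqcost (z : E * E) : R := (2^-1 * enorm (z.1 - z.2) ^+ 2)%R.

Definition cross r : set (E * E) :=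
  (eball d r `*` setT) `|` (setT `*` eball d r).

Definition energy r pi : \bar R :=
  ((r ^+ (d + 2))^-1)%:E * \int[pi]_(z in cross r) (sqcost z)%:E.

End transport.

(* Main.v *)
Require Import Defs.
From HB Require Import structures.
From mathcomp Require Import all_boot all_order all_algebra.
From mathcomp Require Import all_classical all_reals all_analysis.
From mathcomp Require Import measurable_realfun ring lra.
Import Order.TTheory GRing.Theory Num.Theory.
Import numFieldNormedType.Exports.
Local Open Scope classical_set_scope.
Local Open Scope ring_scope.

(** Write B for the ball of radius r and D = B x B. Every coupling of mu and nu
    lives on D, since the complement of the support of a Borel measure on R^d
    is null.

    Adding to a cost a function of x alone and a function of y alone changes
    its integral by the same amount for all couplings. Modulo such functions,
    c differs little from the quadratic cost q(x, y) = |x - y|^2 / 2: subtract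
    from c(x, y) the values c(x, x), c(0, y) and add c(0, x). What remains is
    a mixed second difference of c on the rectangle with sides [0, x] and
    [x, y], which by two applications of the mean value theorem equals
    x^T H (y - x), with H the mixed Hessian of c at some point of D
    ([mixed_difference]). For the quadratic cost the mixed Hessian is -I, so
    the two costs differ by x^T (H + I) (y - x), of absolute value at most
    K r |x - y|, where K is the C^0 norm of H + I on D
    ([cost_sqcost_separation]).

    Young's inequality, with a free parameter a > 0, bounds |x - y| by
    q(x, y) / (a r) + a r / 2. Let A and A' be the Euclidean costs of pi and
    pi'. Comparing pi and pi' through the c-optimality of pi
    ([almost_minimal_of_close_cost]) gives
      A <= A' + (K / a) (A + A') + (K a r^2 / 2) (pi(D) + pi'(D)).
    If A <= A' there is nothing to prove. Otherwise A' is absorbed by A, the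
    masses are at most 2 (2 r)^d because B lies in a cube of side 2 r, and the
    choice of a as the square root of the energy of pi, which makes A equal to
    a^2 r^(d+2), balances the two error terms ([almost_minimal_arith]). This is
    the Cauchy-Schwarz inequality in disguise; it yields C = 2 + 2^(d+1). *)

(** * Borel sets of R^d and of R^d x R^d *)

Section borel.
Context {R : realType} {d : nat}.
Local Notation E := 'rV[R]_d.

Lemma rat_row_ball (x : E) (e : R) : 0 < e ->
  exists q : 'rV[rat]_d, ball (map_mx ratr q : E) e x.
Proof.
move=> e0.
have H j : {q : rat | ball (ratr q : R) e (x 0 j)}.
  apply: cid.
  have /rat_in_itvoo[q /itvP qe] : x 0 j < x 0 j + e by rewrite ltrDl.
  exists q; rewrite /ball/= ger0_norm; last by rewrite subr_ge0 qe.
  by rewrite ltrBlDl qe.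
exists (\row_j sval (H j)); split=> // i j.
by rewrite !mxE (ord1 i); exact: (svalP (H j)).
Qed.

Definition rat_ball (q : nat * 'rV[rat]_d) : set E :=
  ball (map_mx ratr q.2 : E) (q.1.+1%:R^-1).

Lemma rat_ball_basis (x : E) (e : R) : 0 < e ->
  exists q, rat_ball q x /\ rat_ball q `<=` ball x e.
Proof.
move=> e0.
have [n ne] : exists n, n.+1%:R^-1 < e / 2.
  have e20 : 0 < e / 2 by rewrite divr_gt0.
  have [n _ /(_ _ (leqnn n))] := near_infty_natSinv_lt (PosNum e20).
  by exists n.
have n0 : (0 : R) < n.+1%:R^-1 by rewrite invr_gt0 ltr0n.
have [q qx] := rat_row_ball x _ n0.
exists (n, q); split => // y qy.
apply: (le_ball (e1 := n.+1%:R^-1 + n.+1%:R^-1)).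
  by rewrite [leRHS]splitr lerD// ltW.
exact: ball_triangle (ball_sym qx) qy.
Qed.

Lemma borel_open (U : set E) : open U -> measurable U.
Proof. by move=> oU; exact: sub_sigma_algebra. Qed.

Lemma rat_ball_measurable q : measurable (rat_ball q).
Proof. by apply: borel_open; apply: ball_open; rewrite invr_gt0 ltr0n. Qed.

(** The measurable sets of the product are those of the product sigma-algebra,
    so an open set has to be exhibited as a countable union of rectangles; the
    rational cubes form a countable basis which makes this possible. *)
Lemma borel_open_prod (U : set (E * E)) : open U -> measurable U.
Proof.
move=> oU.
pose F (q : (nat * 'rV[rat]_d) * (nat * 'rV[rat]_d)) : set (E * E) :=
  if `[< rat_ball q.1 `*` rat_ball q.2 `<=` U >]
  then rat_ball q.1 `*` rat_ball q.2 else set0.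
rewrite (_ : U = \bigcup_q F q).
  apply: countable_bigcupT_measurable => // -[q1 q2]; rewrite /F/=.
  by case: asboolP => // _; apply: measurableX; exact: rat_ball_measurable.
apply/seteqP; split => [z Uz|z [q _]]; last first.
  by rewrite /F; case: asboolP => // + zq; exact.
move: oU; rewrite openE => /(_ _ Uz)/nbhs_ballP[e /= e0 eU].
have [q1 [q1z q1e]] := rat_ball_basis z.1 _ e0.
have [q2 [q2z q2e]] := rat_ball_basis z.2 _ e0.
exists (q1, q2) => //; rewrite /F/=; case: asboolP => //.
by case=> -[x y] [/= /q1e xz /q2e yz]; exact: eU.
Qed.

(** Lindelof argument: a point outside the support lies in a null rational
    cube, and there are countably many of them. *)
Lemma Spt_conull (mu : {measure set E -> \bar R}) : mu.-negligible (~` Spt mu).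
Proof.
pose F (n : nat) : set E := if unpickle n is Some q then
  if mu (rat_ball q) == 0%E then rat_ball q else set0 else set0.
apply: (@negligibleS _ _ _ _ (\bigcup_n F n)); last first.
  apply: negligible_bigcup => n; rewrite /F.
  case: unpickle => [q|]; last exact: negligible_set0.
  case: eqP => [q0|_]; last exact: negligible_set0.
  by apply/negligibleP => //; exact: rat_ball_measurable.
move=> x /= /existsNP[U /not_implyP[oU /not_implyP[Ux /negP]]].
rewrite lt0e measure_ge0 andbT negbK => /eqP U0.
have mU := borel_open U oU.
move: (oU); rewrite openE => /(_ _ Ux)/nbhs_ballP[e /= e0 eU].
have [q [qx qe]] := rat_ball_basis x _ e0.
exists (pickle q) => //; rewrite /F pickleK ifT//; apply/eqP.
apply: (subset_measure0 _ mU _ U0); first exact: rat_ball_measurable.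
exact: subset_trans eU.
Qed.

End borel.

(** * Euclidean norm and balls *)

Section euclid.
Context {R : realType}.

(** With A, B the sums of squares and P the sum of products, expanding the sum
    of the squares of B a_i - P b_i gives B (A B - P^2), which is thus
    nonnegative. *)
Lemma sum_cauchy_schwarz (I : finType) (a b : I -> R) :
  `|\sum_i a i * b i| <= Num.sqrt (\sum_i a i ^+ 2) * Num.sqrt (\sum_i b i ^+ 2).
Proof.
rewrite -sqrtrM ?sumr_ge0// => [|i _]; last exact: sqr_ge0.
rewrite -sqrtr_sqr ler_wsqrtr//.
set A := \sum_i a i ^+ 2; set B := \sum_i b i ^+ 2; set P := \sum_i a i * b i.
have B0 : 0 <= B by apply: sumr_ge0 => i _; exact: sqr_ge0.
have /orP[/eqP B_eq0|B_gt0] : (B == 0) || (0 < B) by rewrite -le0r.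
  suff -> : P = 0 by rewrite expr0n/= B_eq0 mulr0.
  apply: big1 => i _.
  have /eqP : b i ^+ 2 = 0.
    by apply: (psumr_eq0P (fun i _ => sqr_ge0 (b i)) B_eq0).
  by rewrite sqrf_eq0 => /eqP ->; rewrite mulr0.
have : 0 <= B * (A * B - P ^+ 2).
  suff <- : \sum_i (B * a i - P * b i) ^+ 2 = B * (A * B - P ^+ 2).
    by apply: sumr_ge0 => i _; exact: sqr_ge0.
  transitivity (\sum_i (B ^+ 2 * a i ^+ 2 - 2 * B * P * (a i * b i)
                        + P ^+ 2 * b i ^+ 2)).
    by apply: eq_bigr => i _; ring.
  rewrite big_split/= sumrB -!big_distrr/= -/A -/B -/P; ring.
by rewrite pmulr_rge0// subr_ge0.
Qed.

Lemma enorm_ge0 m n (A : 'M[R]_(m, n)) : 0 <= enorm A.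
Proof. exact: sqrtr_ge0. Qed.

Lemma enorm_rowE n (x : 'rV[R]_n) : enorm x = Num.sqrt (\sum_j x 0 j ^+ 2).
Proof. by rewrite /enorm big_ord1. Qed.

Lemma enorm_row_sqr n (x : 'rV[R]_n) : enorm x ^+ 2 = \sum_j x 0 j ^+ 2.
Proof.
by rewrite enorm_rowE sqr_sqrtr// sumr_ge0// => j _; exact: sqr_ge0.
Qed.

Lemma bilinear_le_enorm n (u w : 'rV[R]_n) (A : 'M[R]_n) :
  `|\sum_i \sum_j u 0 i * w 0 j * A i j| <= enorm A * (enorm u * enorm w).
Proof.
rewrite pair_bigA/=.
apply: (le_trans (sum_cauchy_schwarz _ (fun p => u 0 p.1 * w 0 p.2)
                                       (fun p => A p.1 p.2))).
rewrite mulrC /enorm pair_bigA/= ler_wpM2l ?sqrtr_ge0// !big_ord1.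
rewrite -sqrtrM; last by apply: sumr_ge0 => j _; exact: sqr_ge0.
rewrite ler_wsqrtr// big_distrlr/= pair_bigA/= le_eqVlt; apply/orP; left.
by apply/eqP/eq_bigr => -[i j] _ /=; rewrite exprMn.
Qed.

Lemma eballP d (r : R) (x : 'rV[R]_d) : 0 < r ->
  eball d r x <-> \sum_j x 0 j ^+ 2 < r ^+ 2.
Proof.
move=> r0; rewrite /eball/= -enorm_row_sqr.
by rewrite ltr_pXn2r// nnegrE ?enorm_ge0// ltW.
Qed.

Lemma eball0 d (r : R) : 0 < r -> eball d r 0.
Proof.
move=> r0; apply/eballP => //; rewrite big1 ?exprn_gt0// => j _.
by rewrite mxE expr0n.
Qed.

(** Convexity of the square, applied in each coordinate, spares the triangle
    inequality of the Euclidean norm. *)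
Lemma eball_convex d (r : R) (x y : 'rV[R]_d) (t : R) : 0 < r ->
  0 <= t <= 1 -> eball d r x -> eball d r y -> eball d r (x + t *: (y - x)).
Proof.
move=> r0 /andP[t0 t1] /(eballP _ _ _ r0) xr /(eballP _ _ _ r0) yr.
apply/(eballP _ _ _ r0).
apply: (@le_lt_trans _ _ ((1 - t) * (\sum_j x 0 j ^+ 2) + t * (\sum_j y 0 j ^+ 2))).
  rewrite !big_distrr/= -big_split/=; apply: ler_sum => j _; rewrite !mxE.
  rewrite -subr_ge0 (_ : _ - _ = t * (1 - t) * (x 0 j - y 0 j) ^+ 2); last by ring.
  by rewrite mulr_ge0 ?sqr_ge0// mulr_ge0// subr_ge0.
move: xr yr; set a := \sum_j _; set b := \sum_j _ => ar br.
have [->|tn0] := eqVneq t 0; first by rewrite subr0 mul1r mul0r addr0.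
have {}t0 : 0 < t by rewrite lt_neqAle eq_sym tn0.
rewrite (_ : r ^+ 2 = (1 - t) * r ^+ 2 + t * r ^+ 2); last by ring.
by rewrite ler_ltD ?ler_wpM2l ?subr_ge0 ?ltr_pM2l// ltW.
Qed.

Lemma cvg_fin_sum (T : Type) (F : set_system T) (I : finType)
    (f : I -> T -> R) (l : I -> R) : Filter F ->
  (forall i, f i x @[x --> F] --> l i) ->
  \sum_i f i x @[x --> F] --> \sum_i l i.
Proof.
move=> FF fl; apply: cvg_big => [|i _]; last exact: fl.
by move=> [a b]; exact: add_continuous.
Qed.

Lemma enorm_cvg (T : Type) (F : set_system T) m n (f : T -> 'M[R]_(m, n))
    (A : 'M[R]_(m, n)) : Filter F ->
  (forall i j, f x i j @[x --> F] --> A i j) ->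
  enorm (f x) @[x --> F] --> enorm A.
Proof.
move=> FF fA; apply: (continuous_cvg _ (@sqrt_continuous R _)).
apply: cvg_fin_sum => i; apply: cvg_fin_sum => j.
exact: (continuous_cvg _ (@exprn_continuous R 2 _) (fA i j)).
Qed.

Lemma enorm_continuous n : continuous (@enorm R 1 n).
Proof. by move=> x; apply: (@enorm_cvg _ (nbhs x) 1 n id x) => i j; exact: coord_continuous. Qed.

Lemma eball_open d (r : R) : open (eball d r).
Proof.
rewrite (_ : eball d r = @enorm R 1 d @^-1` [set y | y < r])//.
by apply: open_comp => // x _; exact: enorm_continuous.
Qed.

End euclid.

(** * Mean value formula for mixed second differences *)

Section mixed_second_difference.
Context {R : realType}.

Lemma is_derive_line (V : normedModType R) (f : V -> R) (a v : V) (t : R) :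
  differentiable f (a + t *: v) ->
  is_derive t 1 (fun s : R => f (a + s *: v)) ('D_v f (a + t *: v)).
Proof.
move=> df.
have dl : is_diff t (fun s : R => a + s *: v) (fun s : R => s *: v).
  have -> : (fun s : R => a + s *: v) = cst a + ( *:%R^~ v) by [].
  apply: DiffDef; first by apply: differentiableD.
  rewrite diffD// diff_cst diff_val. by apply/funext => s /=; rewrite add0r.
have dfl : differentiable (f \o (fun s : R => a + s *: v)) t.
  exact: differentiable_comp.
apply: DeriveDef; first exact/derivable1_diffP.
by rewrite deriveE// diff_comp//= diff_val deriveE//= scale1r.
Qed.

Context {d : nat}.
Local Notation E := 'rV[R]_d.

Lemma derivex_partial (f : E * E -> R) z (u : E) : differentiable f z ->
  'D_(u, 0) f z = \sum_i u 0 i * partialx i f z.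
Proof.
move=> df; rewrite deriveE//.
have -> : (u, 0 : E) = \sum_i u 0 i *: ((delta_mx 0 i, 0) : E * E).
  rewrite [RHS]surjective_pairing !raddf_sum/=; congr pair.
    exact: row_sum_delta.
  by rewrite big1// => i _; rewrite scaler0.
by rewrite linear_sum; apply: eq_bigr => i _; rewrite linearZ/= /partialx deriveE.
Qed.

Lemma derivey_partial (f : E * E -> R) z (w : E) : differentiable f z ->
  'D_(0, w) f z = \sum_j w 0 j * partialy j f z.
Proof.
move=> df; rewrite deriveE//.
have -> : (0 : E, w) = \sum_j w 0 j *: ((0, delta_mx 0 j) : E * E).
  rewrite [RHS]surjective_pairing !raddf_sum/=; congr pair.
    by rewrite big1// => i _; rewrite scaler0.
  exact: row_sum_delta.
by rewrite linear_sum; apply: eq_bigr => i _; rewrite linearZ/= /partialy deriveE.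
Qed.

Lemma mvt01 (f df : R -> R) :
  (forall t : R, 0 <= t <= 1 -> is_derive t 1 f (df t)) ->
  exists2 t : R, 0 <= t <= 1 & f 1 - f 0 = df t.
Proof.
move=> fdf.
have df01 (t : R) : t \in `]0, 1[ -> is_derive t 1 f (df t).
  by rewrite in_itv/= => /andP[t0 t1]; apply: fdf; rewrite !ltW.
have cf : {within `[0, 1], continuous f}.
  by apply: derivable_within_continuous => t; rewrite in_itv/= => /fdf[].
have [t] := MVT_segment ler01 df01 cf.
by rewrite in_itv/= => t01; rewrite subr0 mulr1; exists t.
Qed.

(** The mean value theorem is applied to the increment in x of c as a function
    of the position on the segment in y, then to the resulting y-derivative as
    a function of the position on the segment in x; the intermediate point of
    the first step must be fixed before the second. *)
Lemma mixed_difference (U : set (E * E)) (c : E * E -> R) (x0 y0 u w : E) :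
  Ck_on 2 U c ->
  (forall s t : R, 0 <= s <= 1 -> 0 <= t <= 1 -> U (x0 + s *: u, y0 + t *: w)) ->
  exists s t : R, [/\ 0 <= s <= 1, 0 <= t <= 1 &
    c (x0 + u, y0 + w) - c (x0, y0 + w) - (c (x0 + u, y0) - c (x0, y0)) =
    \sum_i \sum_j u 0 i * w 0 j * hessxy c (x0 + s *: u, y0 + t *: w) i j].
Proof.
move=> [dc c2] Ust.
have dc1 v z : U z -> differentiable (fun z => 'D_v c z) z by have [+ _] := c2 v; exact.
have I0 : 0 <= (0 : R) <= 1 by rewrite lexx ler01.
have I1 : 0 <= (1 : R) <= 1 by rewrite lexx ler01.
pose phi t := c (x0 + u, y0 + t *: w) - c (x0, y0 + t *: w).
have [t t01 phit] : exists2 t : R, 0 <= t <= 1 & phi 1 - phi 0 =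
    'D_(0, w) c (x0 + u, y0 + t *: w) - 'D_(0, w) c (x0, y0 + t *: w).
  apply: mvt01 => t t01.
  have lineE x : (fun t => c (x, y0 + t *: w)) =
      (fun t => c ((x, y0) + t *: ((0, w) : E * E))).
    apply/funext => s; congr c; apply/pair_equal_spec.
    by rewrite /= scaler0 addr0.
  have linet x : (x, y0 + t *: w) = (x, y0) + t *: ((0, w) : E * E).
    by apply/pair_equal_spec; rewrite /= scaler0 addr0.
  apply: is_deriveB; rewrite lineE linet; apply: is_derive_line; rewrite -linet; apply: dc.
    by have := Ust _ _ I1 t01; rewrite scale1r.
  by have := Ust _ _ I0 t01; rewrite scale0r addr0.
pose q := y0 + t *: w.
pose psi s := \sum_j w 0 j *: (fun s => partialy j c (x0 + s *: u, q)) s.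
pose dpsi s := \sum_j w 0 j *: 'D_(u, 0) (partialy j c) (x0 + s *: u, q).
have [s s01 psis] : exists2 s : R, 0 <= s <= 1 & psi 1 - psi 0 = dpsi s.
  apply: mvt01 => s s01.
  rewrite (_ : psi = \sum_j (w 0 j \*: (fun s => partialy j c (x0 + s *: u, q)))); last first.
    by apply/funext => s'; rewrite fct_sumE.
  apply: is_derive_sum => j; apply: is_deriveZ.
  have lines s' : (x0 + s' *: u, q) = (x0, q) + s' *: ((u, 0) : E * E).
    by apply/pair_equal_spec; rewrite /= scaler0 addr0.
  rewrite (_ : (fun _ => _) =
    (fun s => partialy j c ((x0, q) + s *: ((u, 0) : E * E)))); last first.
    by apply/funext => s'; rewrite lines.
  rewrite lines; apply: is_derive_line; rewrite -lines.
  by apply: dc1; exact: Ust.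
exists s, t; split => //.
move: phit; rewrite /phi scale1r scale0r addr0 => phit.
have U1 : U (x0 + u, q) by have := Ust _ _ I1 t01; rewrite scale1r.
have U0 : U (x0, q) by have := Ust _ _ I0 t01; rewrite scale0r addr0.
transitivity (psi 1 - psi 0).
  rewrite phit !derivey_partial; [|exact: dc..].
  by congr (_ - _); apply: eq_bigr => j _; rewrite ?scale1r ?scale0r ?addr0.
rewrite psis /dpsi exchange_big; apply: eq_bigr => j _ /=.
rewrite derivex_partial; last by apply: dc1; exact: Ust.
rewrite scaler_sumr; apply: eq_bigr => i _.
by rewrite /hessxy mxE [LHS]mulrCA mulrA.
Qed.

End mixed_second_difference.

(** * Perturbation of the cost in optimal transport *)

Section perturbation.
Context {R : realType}.

(** On a set of finite measure these functions are integrable; being closed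
    under the operations needed below, they keep integrability side conditions
    out of the argument. *)
Definition bdd_measurable {d} {T : measurableType d} (D : set T) (f : T -> R) :=
  measurable_fun D f /\ exists M, forall x, D x -> `|f x| <= M.

Lemma bdd_measurable_integrable d (T : measurableType d) (D : set T) f
    (m : {measure set T -> \bar R}) : measurable D -> (m D < +oo)%E ->
  bdd_measurable D f -> m.-integrable D (EFin \o f).
Proof.
move=> mD mDoo [mf [M fM]]; apply: measurable_bounded_integrable => //.
exists M; split; first exact: num_real.
by move=> x Mx y /fM /le_trans; apply; exact: ltW.
Qed.

Lemma bdd_measurableS d (T : measurableType d) (D D' : set T) f :
  measurable D' -> D `<=` D' -> bdd_measurable D' f -> bdd_measurable D f.
Proof.
move=> mD' DD' [mf [M fM]]; split; first exact: measurable_funS mf.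
by exists M => z /DD'; exact: fM.
Qed.

Lemma bdd_measurableD d (T : measurableType d) (D : set T) f g :
  bdd_measurable D f -> bdd_measurable D g -> bdd_measurable D (f \+ g).
Proof.
move=> [mf [M fM]] [mg [N gN]]; split; first exact: measurable_funD.
by exists (M + N) => x Dx; rewrite (le_trans (ler_normD _ _))// lerD ?fM ?gN.
Qed.

Lemma bdd_measurableB d (T : measurableType d) (D : set T) f g :
  bdd_measurable D f -> bdd_measurable D g -> bdd_measurable D (f \- g).
Proof.
move=> [mf [M fM]] [mg [N gN]]; split; first exact: measurable_funB.
by exists (M + N) => x Dx; rewrite (le_trans (ler_normB _ _))// lerD ?fM ?gN.
Qed.

Lemma bdd_measurable_affine d (T : measurableType d) (D : set T) f k l :
  bdd_measurable D f -> bdd_measurable D (fun x => k * f x + l).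
Proof.
move=> [mf [M fM]]; split.
  by apply: measurable_funD => //; apply: measurable_funM.
exists (`|k| * M + `|l|) => x Dx; rewrite (le_trans (ler_normD _ _))//.
by rewrite lerD2r normrM ler_wpM2l ?fM.
Qed.

Lemma bdd_measurable_comp d1 (T1 : measurableType d1) d2 (T2 : measurableType d2)
    (D : set T1) (B : set T2) (phi : T1 -> T2) (f : T2 -> R) :
  measurable B -> measurable_fun setT phi -> measurable D ->
  (forall x, D x -> B (phi x)) ->
  bdd_measurable B f -> bdd_measurable D (fun x => f (phi x)).
Proof.
move=> mB mphi mD DB [mf [M fM]]; split; last by exists M => x /DB /fM.
apply: (measurable_comp mB) => //; first by move=> _ [x Dx <-]; exact: DB.
exact: measurable_funTS.
Qed.

Lemma integral_conull d (T : measurableType d) (C D : set T) (f : T -> \bar R)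
    (m : {measure set T -> \bar R}) : measurable C -> measurable D ->
  D `<=` C -> m (~` D) = 0%E -> m.-integrable C f ->
  (\int[m]_(x in C) f x = \int[m]_(x in D) f x)%E.
Proof.
move=> mC mD DC D0 fi; rewrite (negligible_integral (measurableC mD) mC fi D0).
by rewrite setDE setCK setIidr.
Qed.

Lemma ge0_integral_conull d (T : measurableType d) (C D : set T) (f : T -> \bar R)
    (m : {measure set T -> \bar R}) : measurable C -> measurable D ->
  D `<=` C -> m (~` D) = 0%E -> measurable_fun C f ->
  (forall x, C x -> (0 <= f x)%E) ->
  (\int[m]_(x in C) f x = \int[m]_(x in D) f x)%E.
Proof.
move=> mC mD DC D0 mf f0.
rewrite (ge0_negligible_integral (measurableC mD) mC mf f0 D0).
by rewrite setDE setCK setIidr.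
Qed.

Lemma conull_fin_measure d (T : measurableType d) (D : set T)
    (m : {measure set T -> \bar R}) : measurable D -> m (~` D) = 0%E ->
  (m D < +oo -> m setT < +oo)%E.
Proof.
move=> mD D0 moo; rewrite -(setUv D) measureU ?setICr//; last exact: measurableC.
by rewrite [X in (_ + X)%E]D0 adde0.
Qed.

(** The integral only depends on the image measure of m under phi. Restricting
    to D is harmless as its complement is null, but f is only controlled on B,
    so it is extended by zero to make the change of variables on the whole
    space. *)
Lemma Rintegral_eq_law d1 (T1 : measurableType d1) d2 (T2 : measurableType d2)
    (D : set T1) (B : set T2) (phi : T1 -> T2) (f : T2 -> R)
    (m m' : {measure set T1 -> \bar R}) :
  measurable D -> measurable B -> measurable_fun setT phi ->
  (forall x, D x -> B (phi x)) ->
  m (~` D) = 0%E -> m' (~` D) = 0%E -> (m D < +oo)%E -> (m' D < +oo)%E ->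
  (forall A, measurable A -> pushforward m phi A = pushforward m' phi A) ->
  bdd_measurable B f ->
  \int[m]_(x in D) f (phi x) = \int[m']_(x in D) f (phi x).
Proof.
move=> mD mB mphi DB mD0 mD'0 moo m'oo mm' [mf [M fM]].
have mfB : measurable_fun setT (f \_ B) by apply/(measurable_restrictT f mB).
have bf : bdd_measurable setT (f \_ B).
  split => //; exists `|M| => x _; rewrite patchE; case: ifPn => [/set_mem/fM|_].
    by move=> /le_trans; apply; exact: ler_norm.
  by rewrite normr0.
have bfphi : bdd_measurable setT (fun x => (f \_ B) (phi x)).
  exact: (bdd_measurable_comp _ _ _ _ _ setT).
have E (n : {measure set T1 -> \bar R}) : n (~` D) = 0%E -> (n D < +oo)%E ->
    (\int[n]_(x in D) (f (phi x))%:E =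
     \int[pushforward n phi]_(y in setT) ((f \_ B) y)%:E)%E.
  move=> nD0 nD.
  have ni : n.-integrable setT (EFin \o (fun x => (f \_ B) (phi x))).
    by apply: bdd_measurable_integrable => //; exact: conull_fin_measure nD.
  rewrite integral_pushforward//; last exact/measurable_EFinP.
  rewrite preimage_setT (integral_conull _ _ _ _ _ _ measurableT mD (@subsetT _ D) nD0 ni).
  apply: eq_integral => x; rewrite inE => Dx /=.
  by rewrite patchE ifT// inE; exact: DB.
rewrite /Rintegral !E//; congr fine.
by apply: eq_measure_integral => A mA _; exact: mm'.
Qed.

(** Since f and g have the same integrals against m and m', the measure m is
    also minimal for c - f - g against m', and this cost is within k q + l of q. *)
Lemma almost_minimal_of_close_cost d1 (T1 : measurableType d1) d2
    (T2 : measurableType d2) (B1 : set T1) (B2 : set T2)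
    (m m' : {measure set (T1 * T2) -> \bar R})
    (c q : T1 * T2 -> R) (f : T1 -> R) (g : T2 -> R) (k l : R) :
  let D := B1 `*` B2 in
  measurable B1 -> measurable B2 ->
  m (~` D) = 0%E -> m' (~` D) = 0%E -> (m D < +oo)%E -> (m' D < +oo)%E ->
  (forall A, measurable A -> pushforward m fst A = pushforward m' fst A) ->
  (forall A, measurable A -> pushforward m snd A = pushforward m' snd A) ->
  bdd_measurable D c -> bdd_measurable D q ->
  bdd_measurable B1 f -> bdd_measurable B2 g ->
  (forall z, D z -> `|c z - q z - f z.1 - g z.2| <= k * q z + l) ->
  \int[m]_(z in D) c z <= \int[m']_(z in D) c z ->
  \int[m]_(z in D) q z <= \int[m']_(z in D) q z +
    k * (\int[m]_(z in D) q z + \int[m']_(z in D) q z) +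
    l * (fine (m D) + fine (m' D)).
Proof.
move=> D mB1 mB2 m0 m'0 moo m'oo mm1 mm2 bc bq bf bg cq opt.
have mD : measurable D by exact: measurableX.
have bf1 : bdd_measurable D (fun z => f z.1).
  by apply: (bdd_measurable_comp _ _ _ _ _ B1) => // z [].
have bg2 : bdd_measurable D (fun z => g z.2).
  by apply: (bdd_measurable_comp _ _ _ _ _ B2) => // z [].
(* the marginals agree, so f and g drop out of the comparison *)
have feq : \int[m]_(z in D) f z.1 = \int[m']_(z in D) f z.1.
  by apply: (Rintegral_eq_law _ _ _ _ _ B1 fst) => // z [].
have geq : \int[m]_(z in D) g z.2 = \int[m']_(z in D) g z.2.
  by apply: (Rintegral_eq_law _ _ _ _ _ B2 snd) => // z [].
have bfg : bdd_measurable D (fun z => f z.1 + g z.2) by exact: bdd_measurableD.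
have aff (n : {measure set (T1 * T2) -> \bar R}) (a b : R) : (n D < +oo)%E ->
    n.-integrable D (EFin \o (fun z => (a * q z + b) + (f z.1 + g z.2))) /\
    \int[n]_(z in D) ((a * q z + b) + (f z.1 + g z.2)) =
    a * \int[n]_(z in D) q z + b * fine (n D) +
    (\int[n]_(z in D) f z.1 + \int[n]_(z in D) g z.2).
  move=> noo; have I h := bdd_measurable_integrable _ _ _ h n mD noo.
  have bcst b' : bdd_measurable D (cst b') by split => //; exists `|b'|.
  have baq : bdd_measurable D (fun z => a * q z).
    have := bdd_measurable_affine _ _ _ _ a 0 bq.
    by under eq_fun do rewrite addr0.
  split; first by apply/I/bdd_measurableD => //; exact: bdd_measurable_affine.
  rewrite RintegralD//; [|by apply/I; exact: bdd_measurable_affine|exact: I].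
  rewrite (RintegralD mD (I _ baq) (I _ (bcst b))).
  by rewrite (RintegralD mD (I _ bf1) (I _ bg2)) RintegralZl ?Rintegral_cst//; exact: I.
have [ilo elo] := aff m (1 - k) (- l) moo.
have [ihi ehi] := aff m' (1 + k) l m'oo.
have lo : \int[m]_(z in D) (((1 - k) * q z - l) + (f z.1 + g z.2)) <=
          \int[m]_(z in D) c z.
  apply: le_Rintegral => //; first exact: bdd_measurable_integrable.
  by move=> z /cq; rewrite ler_norml => /andP[+ _]; lra.
have hi : \int[m']_(z in D) c z <=
          \int[m']_(z in D) (((1 + k) * q z + l) + (f z.1 + g z.2)).
  apply: le_Rintegral => //; first exact: bdd_measurable_integrable.
  by move=> z /cq; rewrite ler_norml => /andP[_ +]; lra.
have := le_trans (le_trans lo opt) hi; rewrite elo ehi feq geq; lra.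
Qed.

End perturbation.

(** * Regularity of the cost and comparison with the quadratic cost *)

Section regularity.
Context {R : realType} {d : nat}.
Local Notation E := 'rV[R]_d.

Lemma borel_closed_prod (K : set (E * E)) : closed K -> measurable K.
Proof.
move=> cK; rewrite -(setCK K); apply: measurableC.
by apply: borel_open_prod; exact: closed_openC.
Qed.

Lemma borel_compact_prod (K : set (E * E)) : compact K -> measurable K.
Proof.
move=> cK; apply: borel_closed_prod; apply: compact_closed cK.
exact: norm_hausdorff.
Qed.

Lemma measurable_fun_continuous_on (U : set (E * E)) (f : E * E -> R) :
  open U -> (forall z, U z -> {for z, continuous f}) -> measurable_fun U f.
Proof.
move=> oU cf; apply: (measurability _ (RGenOpens.measurableE R)).
move=> _ [_ [a [b ->] <-]]; apply: borel_open_prod.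
rewrite openE => z [Uz abz]; apply: filterI.
  by move: oU; rewrite openE; exact.
apply: cf => //; apply: open_nbhs_nbhs; split => //; exact: interval_open.
Qed.

Lemma compact_bound (K : set (E * E)) (f : E * E -> R) : compact K ->
  (forall z, K z -> {for z, continuous f}) ->
  exists M, forall z, K z -> `|f z| <= M.
Proof.
move=> cK cf.
have /compact_bounded[M [_ fM]] : compact (f @` K).
  apply: continuous_compact => //; apply: continuous_in_subspaceT => z.
  by rewrite inE; exact: cf.
by exists (M + 1) => z Kz; apply: fM; [rewrite ltrDl|exists z].
Qed.

Lemma continuous_bdd_measurable (U K : set (E * E)) (f : E * E -> R) :
  open U -> compact K -> K `<=` U ->
  (forall z, U z -> {for z, continuous f}) -> bdd_measurable K f.
Proof.
move=> oU cK KU cf; split; last by apply: compact_bound => // z /KU; exact: cf.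
apply: measurable_funS KU _; first exact: borel_open_prod.
exact: measurable_fun_continuous_on.
Qed.

Lemma sqcost_continuous : continuous (@sqcost R d).
Proof.
move=> z; rewrite /sqcost; apply: cvgMr; apply: (continuous_cvg _ (@exprn_continuous R 2 _)).
apply: continuous_cvg; first exact: enorm_continuous.
by apply: cvgB; [exact: cvg_fst|exact: cvg_snd].
Qed.

Lemma sqcost_ge0 (z : E * E) : 0 <= sqcost z.
Proof. by rewrite mulr_ge0 ?sqr_ge0// invr_ge0. Qed.

Lemma sqcost_sumE (z : E * E) :
  sqcost z = \sum_j 2^-1 * (z.1 0 j - z.2 0 j) ^+ 2.
Proof.
rewrite /sqcost enorm_row_sqr big_distrr/=.
by apply: eq_bigr => j _; rewrite !mxE.
Qed.

Lemma hessxy_continuous (U : set (E * E)) (c : E * E -> R) z i j :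
  Ck_on 2 U c -> U z -> {for z, continuous (fun z => hessxy c z i j)}.
Proof.
move=> [_ c2] Uz.
have [_ c2_ij] := c2 (0, delta_mx 0 j).
rewrite (_ : (fun _ => _) = 'D_(delta_mx 0 i, 0) ('D_(0, delta_mx 0 j) c)).
  exact: c2_ij.
by apply/funext => z'; rewrite mxE.
Qed.

Lemma C0_norm_ub (K A : set (E * E)) (F : E * E -> 'M[R]_d) z :
  compact K -> A `<=` K ->
  (forall z i j, K z -> {for z, continuous (fun z => F z i j)}) ->
  A z -> enorm (F z) <= C0_norm A F.
Proof.
move=> cK AK cF Az.
have [M FM] : exists M, forall z, K z -> `|enorm (F z)| <= M.
  apply: compact_bound => // z' Kz'; apply: (enorm_cvg _ (nbhs z')) => i j; exact: cF.
apply: ub_le_sup; last by exists z.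
by exists M => _ [z' Az' <-]; rewrite (le_trans (ler_norm _))// FM//; exact: AK.
Qed.

(** Splitting c - q into a function of x, a function of y and a remainder: the
    values of c subtracted here form the mixed difference of c at the corners
    0, x (in the first variable) and x, y (in the second), and the quadratic
    terms complete its mixed Hessian by the identity. Anchoring the second
    variable at x is what makes the remainder proportional to |x - y|. *)
Lemma cost_sqcost_separation (U : set (E * E)) (c : E * E -> R) (r : R) (k : R) x y :
  0 < r -> eball d r `*` eball d r `<=` U -> Ck_on 2 U c ->
  (forall z, (eball d r `*` eball d r) z -> enorm (hessxy c z + 1%:M) <= k) ->
  eball d r x -> eball d r y ->
  `|c (x, y) - sqcost (x, y)
    - (c (x, x) - c (0, x) + sqcost (x, 0)) - (c (0, y) - sqcost (0, y))|
  <= k * (r * enorm (x - y)).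
Proof.
move=> r0 BU c2 ck Bx By.
have Bsx (s : R) : 0 <= s <= 1 -> eball d r (s *: x).
  move=> s01; have := eball_convex _ _ _ _ _ r0 s01 (eball0 d _ r0) Bx.
  by rewrite subr0 add0r.
have [s [t [s01 t01]]] : exists s t : R, [/\ 0 <= s <= 1, 0 <= t <= 1 &
    c (x, y) - c (0, y) - (c (x, x) - c (0, x)) =
    \sum_i \sum_j x 0 i * (y - x) 0 j * hessxy c (s *: x, x + t *: (y - x)) i j].
  have [|s [t [s01 t01 e]]] := mixed_difference U c 0 x x (y - x) c2.
    move=> s t s01 t01; apply: BU; split => /=; last exact: eball_convex.
    by rewrite add0r; exact: Bsx.
  by exists s, t; move: e; rewrite !add0r (addrC x) subrK.
set p := s *: x; set q := x + _ => cE.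
have Bpq : (eball d r `*` eball d r) (p, q).
  by split => /=; [exact: Bsx|exact: eball_convex].
have -> : c (x, y) - sqcost (x, y)
    - (c (x, x) - c (0, x) + sqcost (x, 0)) - (c (0, y) - sqcost (0, y)) =
    \sum_i \sum_j x 0 i * (y - x) 0 j * (hessxy c (p, q) + 1%:M) i j.
  transitivity (c (x, y) - c (0, y) - (c (x, x) - c (0, x)) +
    (sqcost (0, y) - sqcost (x, y) - sqcost (x, 0))); first by ring.
  rewrite cE !sqcost_sumE -!sumrB -big_split/=; apply: eq_bigr => i _.
  transitivity (\sum_j x 0 i * (y - x) 0 j * hessxy c (p, q) i j +
                \sum_j x 0 i * (y - x) 0 j * (1%:M : 'M[R]_d) i j); last first.
    by rewrite -big_split/=; apply: eq_bigr => j _; rewrite -mulrDr; congr (_ * _);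
      rewrite [RHS]mxE.
  congr (_ + _); rewrite (bigD1 i)//= big1 ?addr0 => [|j ji].
    by rewrite !mxE eqxx mulr1; field.
  by rewrite [X in _ * X]mxE eq_sym (negbTE ji) mulr0.
apply: (le_trans (bilinear_le_enorm _ _ _ _)).
rewrite ler_pM ?enorm_ge0 ?mulr_ge0 ?enorm_ge0 ?ck// ler_pM ?enorm_ge0//.
  exact: ltW.
rewrite !enorm_rowE le_eqVlt; apply/orP; left; apply/eqP; congr Num.sqrt.
by apply: eq_bigr => j _; rewrite !mxE -sqrrN opprB.
Qed.

(** The ball is covered by a cube of side 2 r and by degenerate boxes, whose
    volume is zero because d > 0. *)
Lemma lebesgue_eball_le (r : R) : (0 < d)%N -> 0 < r ->
  (lebesgue_rV (eball d r) <= ((2 * r) ^+ d)%:E)%E.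
Proof.
move=> d0 r0; apply: ereal_inf_lbound => /=.
pose J (k : nat) : E * E :=
  if k is 0 then (const_mx (- r), const_mx r) else (0, 0).
exists J; first split.
- by move=> [|k] i /=; rewrite !mxE// ge0_cp// ltW.
- move=> x /(eballP _ _ _ r0) xr; exists 0%N => // i; rewrite /= !mxE -ler_norml.
  rewrite -(@ler_pXn2r _ 2) ?nnegrE//; last exact: ltW.
  rewrite real_normK ?num_real// (le_trans _ (ltW xr))//.
  by rewrite (bigD1 i)//= lerDl sumr_ge0// => j _; exact: sqr_ge0.
rewrite nneseries_recl//; last first.
  move=> [|k] _ /=; rewrite lee_fin prodr_ge0// => i _; rewrite !mxE ?subrr//.
  by rewrite opprK addr_ge0// ltW.
rewrite eseries0 ?adde0; last first.
  move=> [|k]//= _ _; rewrite (bigD1 (Ordinal d0))//= !mxE subrr mul0r//.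
congr (_%:E); under eq_bigr do rewrite !mxE opprK -mulr2n -mulr_natl.
by rewrite big_const_ord iter_mulr_1.
Qed.

End regularity.

(** * Couplings of measures supported in a ball *)

Section balls.
Context {R : realType} {d : nat}.
Local Notation E := 'rV[R]_d.

Lemma Spt_sub_conull (mu : {measure set E -> \bar R}) (B : set E) :
  measurable B -> Spt mu `<=` B -> mu (~` B) = 0%E.
Proof.
move=> mB SB; apply/negligibleP; first exact: measurableC.
apply: negligibleS (Spt_conull mu); exact: subsetC.
Qed.

Lemma coupling_conull (mu nu : {measure set E -> \bar R})
    (pi : {measure set (E * E) -> \bar R}) (B : set E) :
  measurable B -> mu (~` B) = 0%E -> nu (~` B) = 0%E -> coupling mu nu pi ->
  pi (~` (B `*` B)) = 0%E.
Proof.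
move=> mB mu0 nu0 cpl; have mBC := measurableC mB.
have [pi1 _] := cpl _ mBC; have [_ pi2] := cpl _ mBC.
have m1 : measurable (fst @^-1` (~` B) : set (E * E)).
  by rewrite -[X in measurable X]setTI; exact: measurable_fst.
have m2 : measurable (snd @^-1` (~` B) : set (E * E)).
  by rewrite -[X in measurable X]setTI; exact: measurable_snd.
have n1 : pi.-negligible (fst @^-1` (~` B)) by apply/negligibleP => //; rewrite -mu0.
have n2 : pi.-negligible (snd @^-1` (~` B)) by apply/negligibleP => //; rewrite -nu0.
apply/negligibleP; first by apply: measurableC; exact: measurableX.
apply: negligibleS (negligibleU n1 n2) => -[x y] /= /not_andP[nx|ny]; by [left|right].
Qed.

Lemma coupling_le (mu nu : {measure set E -> \bar R})
    (pi : {measure set (E * E) -> \bar R}) (B : set E) :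
  measurable B -> coupling mu nu pi -> (pi (B `*` B) <= mu B)%E.
Proof.
move=> mB cpl; have [<- _] := cpl _ mB; apply: le_measure.
- by rewrite inE; exact: measurableX.
- by rewrite inE -[X in measurable X]setTI; exact: measurable_fst.
- by move=> z [].
Qed.

Lemma sqcost_measurable (D : set (E * E)) : measurable_fun D (@sqcost R d).
Proof.
apply: measurable_funTS; apply: measurable_fun_continuous_on; first exact: openT.
by move=> z _; exact: sqcost_continuous.
Qed.

Lemma cross_measurable (r : R) : measurable (@cross R d r).
Proof.
have mB : measurable (eball d r : set E) by apply: borel_open; exact: eball_open.
by apply: measurableU; apply: measurableX.
Qed.

End balls.

(** Optimization of the Young parameter: a is the square root in the conclusion,
    for which A = a^2 r^(d+2) when A > 0. If A <= A' the bound is trivial, and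
    this covers the case a = 0. *)
Lemma almost_minimal_arith (R : realType) (d : nat) (r K A A' M M' : R) :
  0 < r -> 0 <= K -> 0 <= A -> 0 <= A' ->
  M <= 2 * (2 * r) ^+ d -> M' <= 2 * (2 * r) ^+ d ->
  (forall a, 0 < a ->
     A <= A' + K / a * (A + A') + K * a * r ^+ 2 / 2 * (M + M')) ->
  A <= A' + r ^+ (d + 2) *
    ((2 + 2 ^+ d.+1) * K * Num.sqrt ((r ^+ (d + 2))^-1 * A)).
Proof.
move=> r0 K0 A0 A'0 Mr M'r Aa.
have rd0 : 0 < r ^+ (d + 2) by rewrite exprn_gt0.
set a := Num.sqrt _.
have a0 : 0 <= a by exact: sqrtr_ge0.
have [AA'|AA'] := leP A A'.
  rewrite (le_trans AA')// lerDl; apply: mulr_ge0; first exact: ltW.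
  by apply: mulr_ge0 => //; apply: mulr_ge0 => //; rewrite addr_ge0// exprn_ge0.
have {}A0 : 0 < A by rewrite (le_lt_trans A'0).
have a_gt0 : 0 < a by rewrite sqrtr_gt0 mulr_gt0// invr_gt0.
have Aa2 : A = a ^+ 2 * r ^+ (d + 2).
  rewrite sqr_sqrtr; last by rewrite mulr_ge0 ?invr_ge0// ltW.
  by rewrite mulrAC mulVf ?mul1r// gt_eqF.
have := Aa _ a_gt0; move=> /le_trans; apply.
rewrite -addrA lerD2l.
have -> : r ^+ (d + 2) * ((2 + 2 ^+ d.+1) * K * a) =
   K / a * (A + A) + K * a * r ^+ 2 / 2 * (2 * (2 * r) ^+ d + 2 * (2 * r) ^+ d).
  by rewrite Aa2 exprMn exprD (exprS 2 d); field; rewrite gt_eqF.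
apply: lerD; first by rewrite ler_wpM2l ?divr_ge0// lerD2l ltW.
apply: ler_wpM2l; last exact: lerD.
by apply: mulr_ge0; [apply: mulr_ge0; [exact: mulr_ge0|exact: sqr_ge0]|rewrite invr_ge0].
Qed.

Local Open Scope ereal_scope.

Theorem proposition1p10 (R : realType) (d : nat) (hd : (0 < d)%N) :
  exists C : R,
  forall (X Y : set 'rV[R]_d) (c : 'rV[R]_d * 'rV[R]_d -> R) (r : R)
    (mu nu : {measure set 'rV[R]_d -> \bar R})
    (pi : {measure set ('rV[R]_d * 'rV[R]_d)%type -> \bar R}),
  compact X -> compact Y ->
  cost_function X Y c ->
  (0 < r)%R ->
  eball d r `*` eball d r `<=` X `*` Y ->
  Spt mu `<=` eball d r ->
  Spt nu `<=` eball d r ->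
  mu (eball d r) <= 2%:E * lebesgue_rV (eball d r) ->
  c_optimal X Y c mu nu pi ->
  forall pi' : {measure set ('rV[R]_d * 'rV[R]_d)%type -> \bar R},
  coupling mu nu pi' ->
  \int[pi]_z (sqcost z)%:E <=
  \int[pi']_z (sqcost z)%:E +
  (r ^+ (d + 2))%:E *
  (C%:E *
   (C0_norm (eball d r `*` eball d r) (fun z => (hessxy c z + 1%:M)%R))%:E *
   (energy r pi `^ 2^-1)).
Proof.
exists (2 + 2 ^+ d.+1)%R => X Y c r mu nu pi cX cY [[U [oU XYU c2]] _ _ _] r0 BXY
  Smu Snu mur [cpl opt] pi' cpl'.
set B := eball d r in BXY Smu Snu mur *; set D := B `*` B in BXY *.
set K := C0_norm _ _.
have DU : D `<=` U by exact: subset_trans XYU.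
have cXY : compact (X `*` Y) by exact: compact_setX.
have mXY := borel_compact_prod _ cXY.
have mB : measurable B by apply: borel_open; exact: eball_open.
have mD : measurable D by exact: measurableX.
have mu0 := Spt_sub_conull mu B mB Smu.
have nu0 := Spt_sub_conull nu B mB Snu.
have pi0 := coupling_conull mu nu pi B mB mu0 nu0 cpl.
have pi'0 := coupling_conull mu nu pi' B mB mu0 nu0 cpl'.
have mass : mu B <= (2 * (2 * r) ^+ d)%:E.
  by rewrite (le_trans mur)// EFinM lee_pmul2l//; exact: lebesgue_eball_le.
have piD := le_trans (coupling_le mu nu pi B mB cpl) mass.
have pi'D := le_trans (coupling_le mu nu pi' B mB cpl') mass.
have piDoo : pi D < +oo by rewrite (le_lt_trans piD)// ltry.
have pi'Doo : pi' D < +oo by rewrite (le_lt_trans pi'D)// ltry.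
have fin_mass (p : {measure set ('rV[R]_d * 'rV[R]_d)%type -> \bar R}) :
    p D <= (2 * (2 * r) ^+ d)%:E -> (fine (p D) <= 2 * (2 * r) ^+ d)%R.
  by move=> pD; rewrite -lee_fin fineK// ge0_fin_numE// (le_lt_trans pD)// ltry.
have bc : bdd_measurable (X `*` Y) c.
  apply: (continuous_bdd_measurable U) => // z Uz.
  by have [dc _] := c2; exact/differentiable_continuous/dc.
have bcD : bdd_measurable D c by exact: bdd_measurableS bc.
have bq : bdd_measurable D (@sqcost R d).
  apply: (bdd_measurableS _ _ _ _ _ mXY BXY); apply: (continuous_bdd_measurable setT) => //.
    exact: openT.
  by move=> z _; exact: sqcost_continuous.
have Kub z : D z -> (enorm (hessxy c z + 1%:M) <= K)%R.
  apply: (C0_norm_ub _ D _ _ cXY) => // z' i j z'XY.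
  rewrite (_ : (fun _ => _) = (fun z => hessxy c z i j + (1%:M : 'M[R]_d) i j)%R); last first.
    by apply/funext => w; rewrite [LHS]mxE.
  apply: cvgD; last exact: cvg_cst.
  by apply: (hessxy_continuous U) => //; exact: XYU.
have B0 : B (0 : 'rV[R]_d)%R by exact: eball0.
have K0 : (0 <= K)%R by rewrite (le_trans _ (Kub (0, 0)%R _))// enorm_ge0.
pose A (p : {measure set ('rV[R]_d * 'rV[R]_d)%type -> \bar R}) : R :=
  (\int[p]_(z in D) sqcost z)%R.
have bint f (p : {measure set ('rV[R]_d * 'rV[R]_d)%type -> \bar R}) :
    bdd_measurable D f -> p D < +oo ->
    \int[p]_(z in D) (f z)%:E = (\int[p]_(z in D) f z)%R%:E.
  move=> bf pDoo; rewrite fineK//; apply: integrable_fin_num => //.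
  exact: bdd_measurable_integrable.
have qint (p : {measure set ('rV[R]_d * 'rV[R]_d)%type -> \bar R}) C :
    D `<=` C -> measurable C -> p (~` D) = 0 -> p D < +oo ->
    \int[p]_(z in C) (sqcost z)%:E = (A p)%:E.
  move=> DC mC p0 pDoo; rewrite -(bint _ _ bq pDoo); apply: ge0_integral_conull => //.
    by apply/measurable_EFinP; exact: sqcost_measurable.
  by move=> z _; rewrite lee_fin sqcost_ge0.
have A0 (p : {measure set ('rV[R]_d * 'rV[R]_d)%type -> \bar R}) : (0 <= A p)%R.
  by apply: Rintegral_ge0 => z _; exact: sqcost_ge0.
have cint (p : {measure set ('rV[R]_d * 'rV[R]_d)%type -> \bar R}) : p (~` D) = 0 -> p D < +oo ->
    \int[p]_(z in X `*` Y) (c z)%:E = (\int[p]_(z in D) c z)%R%:E.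
  move=> p0 pDoo; rewrite -(bint _ _ bcD pDoo); apply: integral_conull => //.
  apply: bdd_measurable_integrable => //.
  apply: (le_lt_trans _ (conull_fin_measure _ _ _ p mD p0 pDoo)).
  by apply: le_measure => //; rewrite inE.
have optD : (\int[pi]_(z in D) c z <= \int[pi']_(z in D) c z)%R.
  by rewrite -lee_fin -!cint//; exact: opt.
have bf : bdd_measurable B (fun x => c (x, x) - c (0, x) + sqcost (x, 0))%R.
  apply: bdd_measurableD; first apply: bdd_measurableB;
    by apply: (bdd_measurable_comp _ _ _ _ B D) => //; exact: measurable_fun_pair.
have bg : bdd_measurable B (fun y => c (0, y) - sqcost (0, y))%R.
  by apply: bdd_measurableB;
    apply: (bdd_measurable_comp _ _ _ _ B D) => //; exact: measurable_fun_pair.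
have main a : (0 < a)%R -> (A pi <= A pi' + K / a * (A pi + A pi') +
    K * a * r ^+ 2 / 2 * (fine (pi D) + fine (pi' D)))%R.
  move=> a0; apply: (almost_minimal_of_close_cost _ _ _ _ B B pi pi' c _ _ _ (K / a) _ mB mB
     pi0 pi'0 piDoo pi'Doo _ _ bcD bq bf bg) => //.
  - by move=> S mS; rewrite (cpl _ mS).1 (cpl' _ mS).1.
  - by move=> S mS; rewrite (cpl _ mS).2 (cpl' _ mS).2.
  move=> [x y] [/= Bx By].
  apply: (le_trans (cost_sqcost_separation U c r K x y r0 DU c2 Kub Bx By)).
  rewrite /sqcost/=; set n := enorm _.
  (* Young's inequality, as the expansion of a square *)
  rewrite -subr_ge0 (_ : (_ - _)%R = K / (2 * a) * (n - a * r) ^+ 2)%R.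
    by rewrite mulr_ge0 ?sqr_ge0// divr_ge0// mulr_ge0// ltW.
  by field; rewrite gt_eqF.
have Dcross : D `<=` cross r by move=> z [Bz _]; left.
rewrite /energy !qint//; last exact: cross_measurable.
rewrite poweR_EFin powR12_sqrt; last first.
  by rewrite mulr_ge0// invr_ge0 exprn_ge0// ltW.
rewrite -!EFinM -EFinD lee_fin.
exact: (almost_minimal_arith _ _ _ _ _ _ _ _ r0 K0 (A0 pi) (A0 pi')
  (fin_mass _ piD) (fin_mass _ pi'D) main).
Qed.
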